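(* Fix an integer $k\ge 1$ and consider the statistical manifold of Erlang distributions, with probability density functions $$p(x;\lambda)=\frac{\lambda^k x^{k-1}e^{-\lambda x}}{(k-1)!},\qquad x\in[0,\infty),$$ parametrised by $\lambda\in(0,\infty)$. Its Fisher information is $g_{11}(\lambda)=\frac{k}{\lambda^2}$, and for all $\lambda_1,\lambda_2>0$ the Fisher--Rao distance is $$d_{\mathrm{FR}}(\lambda_1,\lambda_2)=\sqrt{k}\,\left|\log\lambda_1-\log\lambda_2\right|.$$
   Context: For a parametric family $p_\xi=p(x;\xi)$ of probability densities with respect to Lebesgue measure, parametrised by $\xi$ in an open set $\Xi\subseteq\mathbb{R}^d$, the Fisher matrix is $G(\xi)=[g_{ij}(\xi)]$ with $g_{ij}(\xi)=\mathbb{E}_{p_\xi}\left[\frac{\partial\log p_\xi}{\partial\xi^i}\frac{\partial\log p_\xi}{\partial\xi^j}\right]$; when $d=1$ its single entry $g_{11}$ is called the Fisher information. The Fisher--Rao distance $d_{\mathrm{FR}}(\xi_1,\xi_2)$ is the infimum of the lengths $\int_0^1\sqrt{\dot\xi(t)^{\mathsf T}G(\xi(t))\dot\xi(t)}\,\mathrm{d}t$ over piecewise differentiable curves $\xi:[0,1]\to\Xi$ with $\xi(0)=\xi_1$, $\xi(1)=\xi_2$. *)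

(* Defs.v *)
From HB Require Import structures.
From mathcomp Require Import all_boot all_order all_algebra.
From mathcomp Require Import all_classical all_reals all_analysis.

Set Implicit Arguments.
Unset Strict Implicit.
Unset Printing Implicit Defensive.

Import Order.TTheory GRing.Theory Num.Theory.
Import numFieldNormedType.Exports.

Local Open Scope classical_set_scope.
Local Open Scope ring_scope.

(* A parametric family of densities with respect to the Lebesgue measure is
   given by its sample space X, its parameter set Xi and p : xi |-> p_xi. *)

(* Real-valued integral: it is 0 by convention when the integral of h p is
   infinite, so a nonzero value entails a finite expectation. *)
Definition expectation_density (R : realType) (X : set R) (p h : R -> R) : R :=
  (\int[lebesgue_measure]_(x in X) (h x * p x))%R.

(* Partial derivative of log p_xi(x) with respect to the i-th coordinate of xi *)
Definition score (R : realType) (d : nat) (p : 'rV[R]_d -> R -> R)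
    (xi : 'rV[R]_d) (i : 'I_d) (x : R) : R :=
  'D_(delta_mx 0 i) (fun th : 'rV[R]_d => ln (p th x)) xi.

Definition fisher_matrix (R : realType) (d : nat) (X : set R)
    (p : 'rV[R]_d -> R -> R) (xi : 'rV[R]_d) : 'M[R]_d :=
  \matrix_(i, j)
    expectation_density X (p xi) (fun x => score p xi i x * score p xi j x).

(* Differentiability of the restriction of g to [a, b]: the difference
   quotients converge within [a, b], hence one-sidedly at a and b. *)
Definition differentiable_on_segment (R : realType) (d : nat)
    (g : R -> 'rV[R]_d) (a b : R) : Prop :=
  forall t, t \in `[a, b] ->
    cvg ((fun s => (s - t)^-1 *: (g s - g t)) @ within `[a, b] t^').

(* The breakpoints are 0 = (0 :: s)`_0 < s`_0 < ... < last 0 s = 1. Continuity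
   on [0, 1] follows from differentiability on the closed pieces. *)
Definition piecewise_differentiable (R : realType) (d : nat)
    (g : R -> 'rV[R]_d) : Prop :=
  exists s : seq R, itv_partition 0 1 s /\
    forall i : nat, (i < size s)%N ->
      differentiable_on_segment g (nth 0 (0 :: s) i) (nth 0 s i).

Definition admissible_curve (R : realType) (d : nat) (Xi : set 'rV[R]_d)
    (xi1 xi2 : 'rV[R]_d) (g : R -> 'rV[R]_d) : Prop :=
  [/\ piecewise_differentiable g,
      (forall t, t \in `[0, 1] -> Xi (g t)), g 0 = xi1 & g 1 = xi2].

(* The derivative of g is a genuine one except at the finitely many
   breakpoints, which do not contribute to the integral. The length is
   extended-real valued, since the derivative need not be integrable. *)
Definition fisher_length (R : realType) (d : nat) (X : set R)
    (p : 'rV[R]_d -> R -> R) (g : R -> 'rV[R]_d) : \bar R :=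
  (\int[lebesgue_measure]_(t in `[0%R, 1%R])
    (Num.sqrt ((derive1 g t *m fisher_matrix X p (g t) *m (derive1 g t)^T) 0 0))%:E)%E.

Definition fisher_rao_distance (R : realType) (d : nat) (X : set R)
    (Xi : set 'rV[R]_d) (p : 'rV[R]_d -> R -> R) (xi1 xi2 : 'rV[R]_d) :
    \bar R :=
  ereal_inf [set fisher_length X p g | g in admissible_curve Xi xi1 xi2].

(* The Erlang family with shape k; the rate is the single coordinate of a
   1-dimensional parameter. *)
Definition erlang_pdf (R : realType) (k : nat) (l x : R) : R :=
  l ^+ k * x ^+ k.-1 * expR (- l * x) / (k.-1)`!%:R.

Definition erlang_sample_space (R : realType) : set R := `[0, +oo[%classic.

Definition erlang_parameters (R : realType) : set 'rV[R]_1 :=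
  [set xi | 0 < xi 0 0].

Definition erlang_family (R : realType) (k : nat) (xi : 'rV[R]_1) : R -> R :=
  erlang_pdf k (xi 0 0).

(* Main.v *)
Require Import Defs.
From HB Require Import structures.
From mathcomp Require Import all_boot all_order all_algebra.
From mathcomp Require Import all_classical all_reals all_analysis.
From mathcomp Require Import measurable_realfun.
From mathcomp Require Import ring lra.

Import Order.TTheory GRing.Theory Num.Theory.
Import numFieldNormedType.Exports.

Local Open Scope classical_set_scope.
Local Open Scope ring_scope.

(** In the coordinate [sqrt k * ln lambda] the Fisher metric is the Euclidean
    metric of the line, so exponential curves [l1 * exp (m t)] have constant
    speed and realise the distance, and every other curve is at least as long as
    the increment of [sqrt k * ln lambda] along it. Since the curves are merely
    piecewise differentiable, with a derivative that need not be bounded or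
    continuous, the last step requires [|h b - h a| <= int_a^b |h'|] for an
    everywhere differentiable [h], with an integral that may be infinite. For
    this, the level sets [E_n = {n e <= |h'| < (n + 1) e}] are covered by open
    sets [U_n] with [mu (U_n \ E_n)] summably small. The measure
    [nu = sum_n (n + 2) e mu (. & U_n)] dominates the increments of [h] locally,
    hence globally, and [nu `]a, b]] exceeds the integral by [O(e)]. *)

(** * From local to global bounds on increments *)

(** A supremum argument: the set [S] of points up to which the bound holds contains its supremum
    [c], and if [c < b] the local bound at [c] would carry it further. Half-open intervals make
    adjacent pieces disjoint, so [nu] adds over them. *)
Lemma increment_le_measure (R : realType)
    (nu : {measure set measurableTypeR R -> \bar R})
    (h : R -> R) (a b : R) : a <= b ->
  (forall x, a <= x <= b -> \forall y \near x, a <= y <= b ->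
     (`|h y - h x|%:E <= nu `]Order.min x y, Order.max x y]%classic)%E) ->
  (`|h b - h a|%:E <= nu `]a, b]%classic)%E.
Proof.
move=> ab hloc.
pose S := [set s | a <= s <= b /\ (`|h s - h a|%:E <= nu `]a, s]%classic)%E].
have Sa : S a by rewrite /S/= lexx ab subrr normr0; split => //; exact: measure_ge0.
have Sext x y : S x -> x <= y <= b ->
    (`|h y - h x|%:E <= nu `]x, y]%classic)%E -> S y.
  move=> [/andP[ax xb] hx] /andP[xy yb] hxy; split; first by rewrite (le_trans ax xy).
  have -> : `]a, y]%classic = `]a, x] `|` `]x, y] :> set R.
    by rewrite -(@itv_bndbnd_setU _ _ _ (BRight x))// !bnd_simp.
  have xI : (`]a, x] : set R) `&` `]x, y] = set0.
    apply/seteqP; split => // z [] /=; rewrite !in_itv/= => /andP[_ zx] /andP[xz _].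
    by have := lt_le_trans xz zx; rewrite ltxx.
  rewrite measureU//.
  apply: (@le_trans _ _ (`|h x - h a|%:E + `|h y - h x|%:E)%E); last exact: leeD.
  rewrite -EFinD lee_fin [leRHS]addrC.
  by rewrite (_ : h y - h a = (h y - h x) + (h x - h a)) ?ler_normD//; ring.
have Sb : ubound S b by move=> s [/andP[_ ->]].
have supS : has_sup S by split; [exists a|exists b].
pose c := sup S.
have ac : a <= c by apply: sup_ubound => //; exact: supS.2.
have cb : c <= b by apply: ge_sup => //; exists a.
have [e /= e0 He] : nbhs_ball c (fun y => a <= y <= b ->
    (`|h y - h c|%:E <= nu `]Order.min c y, Order.max c y]%classic)%E).
  by apply/nbhs_ballP; apply: hloc; rewrite ac cb.
have Sc : S c.
  have [s Ss] := sup_adherent e0 supS; rewrite -/c => cs.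
  have sc : s <= c by apply: sup_ubound => //; exact: supS.2.
  apply: (Sext s) => //; first by rewrite sc cb.
  have := He s; rewrite /ball/= ger0_norm ?subr_ge0// => /(_ _ Ss.1).
  by rewrite (min_idPr sc) (max_idPl sc) distrC; apply; lra.
have [bc|cb'] := leP b c.
  by have -> : b = c; [apply/le_anti; rewrite bc cb|exact: Sc.2].
pose y := Order.min b (c + e / 2).
have cy : c < y by rewrite lt_min cb'/=; lra.
have yce : y <= c + e / 2 by rewrite ge_min lexx orbT.
have yb : y <= b by rewrite ge_min lexx.
suff Sy : S y.
  have yc : y <= c by apply: sup_ubound => //; exact: supS.2.
  by have := lt_le_trans cy yc; rewrite ltxx.
apply: (Sext c) => //; first by rewrite (ltW cy).
have := He y; rewrite /ball/= ltr0_norm ?subr_lt0// (min_idPl (ltW cy)) (max_idPr (ltW cy)).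
by apply; [lra|rewrite (le_trans ac (ltW cy))].
Qed.

Lemma increment_le_integral (R : realType) (f h : R -> R) (a b : R) : a <= b ->
  measurable_fun `[a, b] f -> (forall x, a <= x <= b -> 0 <= f x) ->
  (forall x, a <= x <= b -> forall e, 0 < e -> \forall y \near x,
     a <= y <= b -> `|h y - h x| <= (f x + e) * `|y - x|) ->
  (`|h b - h a|%:E <= \int[lebesgue_measure]_(x in `[a, b]) (f x)%:E)%E.
Proof.
move=> ab mf f0 hloc; apply/lee_addgt0Pr => e' e'0.
set mu := @lebesgue_measure R.
(* The final excess is [2 e (b - a)], from replacing [f] by [f + 2 e], plus [e], from the covers
   [U n]; this choice makes it exactly [e']. *)
pose e := e' / (2 * (b - a) + 1).
have d0 : 0 < 2 * (b - a) + 1 by lra.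
have e0 : 0 < e by rewrite divr_gt0.
pose E n : set (measurableTypeR R) := `[a, b] `&` f @^-1` `[n%:R * e, n.+1%:R * e[.
have mE n : measurable (E n) by apply: mf.
have Efin n : (mu (E n) < +oo)%E.
  apply: (@le_lt_trans _ _ (mu `[a, b]%classic)).
    by apply: le_measure; rewrite ?inE//; exact: subIsetl.
  by rewrite /mu lebesgue_measure_itv/=; case: ifP => _; rewrite ?ltry// -EFinB ltry.
(* [n + 2] rather than [n + 1]: the local slope bound is [f x + e]. *)
pose c n : R := n.+2%:R * e.
have c0 n : 0 < c n by rewrite mulr_gt0.
(* Weighted by [c n], the surplus of [U n] over [E n] costs at most [e / 2 ^ n.+1], and these bounds
   sum to [e]. *)
pose delta n := e / (2 ^ n.+1)%:R / c n.
have delta0 n : 0 < delta n by rewrite !divr_gt0// ltr0n expn_gt0.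
have /choice[U HU] n : exists U, [/\ open U, E n `<=` U & (mu (U `\` E n) < (delta n)%:E)%E].
  exact: (lebesgue_regularity_outer (mE n) (Efin n) (delta0 n)).
have mU n : measurable (U n : set (measurableTypeR R)).
  by apply: open_measurable; have [] := HU n.
pose nu := mseries (fun n => mscale (NngNum (ltW (c0 n))) (mrestr mu (mU n))) 0.
have Ein x : a <= x <= b -> E (Num.truncn (f x / e)) x.
  move=> xab; have fe0 : 0 <= f x / e by rewrite divr_ge0 ?f0// ltW.
  split; rewrite /= in_itv//= -ler_pdivlMr// -ltr_pdivrMr//.
  exact: truncn_itv.
have tE : trivIset setT E.
  apply/trivIsetP => i j _ _ ij; apply/seteqP; split => // x [[_ xi] [_ xj]].
  have aux n : f x \in `[n%:R * e, n.+1%:R * e[ -> Num.truncn (f x / e) = n.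
    by rewrite in_itv/= -ler_pdivlMr// -ltr_pdivrMr//; exact: truncn_def.
  by move: ij; rewrite -(aux _ xi) (aux _ xj) eqxx.
have bE : \bigcup_n E n = `[a, b]%classic.
  apply/seteqP; split=> [x [n _ []]//|x xab]; exists (Num.truncn (f x / e)) => //.
  by apply: Ein; move: xab; rewrite /= in_itv.
apply: (@le_trans _ _ (nu `]a, b]%classic)).
  apply: increment_le_measure => // x xab.
  (* An interval close enough to [x] stays in the open set [U n], so the single term of index [n] in
     [nu] already gives it mass [c n] times its length. *)
  set n := Num.truncn (f x / e); have [oU EU _] := HU n.
  have Ux : U n x by apply/EU/Ein.
  have [r /= r0 rU] : nbhs_ball x (U n) by apply/nbhs_ballP; move: oU; rewrite openE; exact.
  have := hloc x xab e e0; apply: filterS2 (nbhsx_ballx x r r0) => y xy hy yab.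
  apply: (@le_trans _ _ ((c n)%:E * mu `]Order.min x y, Order.max x y]%classic)%E).
    have -> : mu `]Order.min x y, Order.max x y]%classic = `|y - x|%:E.
      rewrite /mu lebesgue_measure_itv/= lte_fin.
      case: (ltgtP x y) => [xy'|yx|->]; rewrite ?ltxx ?subrr ?normr0//.
        by rewrite xy' gtr0_norm ?subr_gt0// EFinB.
      by rewrite yx ltr0_norm ?subr_lt0// opprB EFinB.
    rewrite -EFinM lee_fin; apply: le_trans (hy yab) _.
    apply: ler_wpM2r => //; rewrite /c.
    have [_] := Ein x xab; rewrite /= in_itv/= -/n => /andP[_ /ltW fn].
    by rewrite -[n.+2]addn1 natrD mulrDl mul1r lerD2r.
  have -> : mu `]Order.min x y, Order.max x y]%classic =
      mrestr mu (mU n) `]Order.min x y, Order.max x y]%classic.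
    rewrite /mrestr/= (_ : _ `&` _ = `]Order.min x y, Order.max x y]%classic)//.
    apply/setIidPl => z /=; rewrite in_itv/= => /andP[z1 z2]; apply: rU.
    move: xy z1 z2; rewrite /ball/= !ltr_norml.
    by case: (ltgtP x y) => [xy'|yx|->] /andP[? ?] ? ?; apply/andP; split; lra.
  rewrite /nu /mseries (@nneseriesD1 _ _ n)//.
  by apply: leeDl; apply: nneseries_ge0 => k _ _; exact: measure_ge0.
(* On [E n] the weight satisfies [c n = n e + 2 e <= f x + 2 e]. *)
pose g (x : R) := (f x + 2 * e)%:E.
have mfE : measurable_fun (\bigcup_n E n) g.
  by rewrite bE; apply/measurable_EFinP; exact: measurable_funD.
have fE0 x : (\bigcup_n E n) x -> (0 <= g x)%E.
  rewrite bE/= in_itv/= => /f0 fx0; rewrite lee_fin; lra.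
apply: (@le_trans _ _ (\sum_(i <oo) (\int[mu]_(x in E i) g x
                         + (e / (2 ^ i.+1)%:R)%:E))%E).
  apply: lee_nneseries => [i _ _|n _]; first exact: measure_ge0.
  have [_ EU dU] := HU n.
  apply: (@le_trans _ _ ((c n)%:E * (mu (E n) + (delta n)%:E))%E).
    rewrite /= /mscale /= lee_pmul2l//; last by rewrite lte_fin.
    apply: (@le_trans _ _ (mu (U n))).
      rewrite /mrestr; apply: le_measure; rewrite ?inE.
      - by apply: measurableI => //; exact: measurable_itv.
      - exact: mU.
      - exact: subIsetr.
    have -> : (mu (U n) = mu (U n `\` E n) + mu (U n `&` E n))%E.
      exact: (measureDI lebesgue_measure (mU n) (mE n)).
    rewrite (setIidr EU) addeC leeD2l//.
    exact: ltW.
  rewrite muleDr//; last by rewrite ge0_adde_def// inE// lee_fin ltW.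
  rewrite leeD//; last first.
    by rewrite -EFinM lee_fin /delta mulrCA divff ?mulr1// gt_eqF.
  rewrite -integral_cst//; apply: ge0_le_integral => //.
  - by move=> x _; rewrite lee_fin ltW.
  - by apply: measurable_funS mfE => //; [exact: bigcup_measurable|exact: bigcup_sup].
  - move=> x [xab]; rewrite /= in_itv/= => /andP[fx _]; rewrite lee_fin /c.
    by rewrite -[n.+2]addn2 natrD mulrDl lerD2r.
apply: le_trans (epsilon_trick _ _ _) _; [|exact: ltW|].
  by move=> n; apply: integral_ge0 => x Ex; apply: fE0; exists n.
rewrite -ge0_integral_bigcup// bE.
under eq_integral do rewrite /g EFinD.
rewrite ge0_integralD//=; [|exact/measurable_EFinP|]; last first.
  by move=> x _; rewrite lee_fin mulr_ge0// ltW.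
rewrite -addeA leeD2l// integral_cst//= lebesgue_measure_itv/=.
have -> : (if (a%:E < b%:E)%E then (b%:E - a%:E)%E else 0%E) = (b - a)%:E.
  case: ifPn => [//|]; rewrite lte_fin -leNgt => ba.
  by rewrite (_ : b = a) ?subrr//; apply/le_anti; rewrite ab ba.
rewrite -EFinM -EFinD lee_fin /e.
by rewrite le_eqVlt; apply/orP; left; apply/eqP; field; rewrite gt_eqF.
Qed.

(** * Difference quotients and derivatives *)

Lemma cvg_shift_dnbhs (R : realType) (s t : R) :
  (fun x : R => x + t) @ s^' --> (s + t)^'.
Proof.
move=> A At; have ct : (fun x : R => x + t) @ s --> s + t.
  by apply: cvgD; [exact: cvg_id|exact: cvg_cst].
have H : \forall x \near s, x + t != s + t -> A (x + t) := ct _ At.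
change (\forall x \near s, x != s -> A (x + t)).
by apply: filterS H => x + xs; apply; rewrite (inj_eq (addIr t)).
Qed.

(** Translates between quotients in [s] tending to [t], the form used for curves, and quotients in a
    step tending to 0, on which [is_derive] rests. *)
Lemma cvg_slope_is_derive (R : realType) (V : normedModType R) (h : R -> V)
    (t : R) (l : V) :
  (fun s => (s - t)^-1 *: (h s - h t)) @ t^' --> l <-> is_derive t 1 h l.
Proof.
split=> [hl|[dh hl]].
  have {}hl : (fun x => x^-1 *: (h (x *: 1 + t) - h t)) @ 0^' --> l.
    have := @cvg_shift_dnbhs R 0 t; rewrite add0r => sh.
    have := cvg_comp _ _ sh hl; apply: cvg_trans; apply: near_eq_cvg.
    by near=> x; rewrite /= addrK [x *: 1]mulr1.
  by apply: DeriveDef; [apply/cvg_ex; exists l|exact: cvg_lim].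
have := @cvg_shift_dnbhs R t (- t); rewrite subrr => sh.
rewrite -hl; have := cvg_comp _ _ sh dh; apply: cvg_trans; apply: near_eq_cvg.
by near=> x; rewrite /= [(x - t) *: 1]mulr1 subrK.
Unshelve. all: by end_near. Qed.

Lemma cvg_slope_continuous (R : realType) (h : R -> R) (t l : R) :
  (fun s => (s - t)^-1 *: (h s - h t)) @ t^' --> l -> {for t, continuous h}.
Proof.
by move=> /cvg_slope_is_derive[/derivable1_diffP dh _]; apply: differentiable_continuous dh.
Qed.

(** An interior point has [[a, b]] as a neighbourhood; hence, away from the ends, differentiability
    on a segment is ordinary differentiability. *)
Lemma within_itv_dnbhs (R : realType) (a b t : R) : a < t < b ->
  within `[a, b] t^' = t^'.
Proof.
move=> /andP[at_ tb]; rewrite eqEsubset; split => W HW; last first.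
  by apply: filterS HW.
have {}HW : \forall x \near t^', `[a, b]%classic x -> W x := HW.
have abx : \forall x \near t^', `[a, b]%classic x.
  apply: nbhs_dnbhs; have tab : t \in `]a, b[ by rewrite in_itv/= at_ tb.
  by apply: filterS (near_in_itvoo tab) => x; exact: subset_itv_oo_cc.
by apply: filterS2 HW abx => x; exact.
Qed.

(** [d] is the pointwise limit of the quotients with step [1 / (n + 1)], which are measurable
    because [h] is continuous on the interval. *)
Lemma measurable_derivative (R : realType) (h d : R -> R) (a b : R) :
  (forall t, a < t < b ->
     (fun s => (s - t)^-1 *: (h s - h t)) @ t^' --> d t) ->
  measurable_fun `]a, b[ d.
Proof.
(* Cutting [h] off outside the interval makes its translates measurable on the whole line. *)
move=> hd; pose hr := h \_ `]a, b[%classic.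
have mhr : measurable_fun setT hr.
  rewrite /hr; apply: (iffLR (measurable_restrictT _ _)) => //; apply: open_continuous_measurable_fun.
    exact: interval_open.
  move=> t; rewrite inE/= in_itv/= => tab.
  by apply: cvg_slope_continuous; exact: hd.
pose q n t := n.+1%:R * (hr (t + n.+1%:R^-1) - hr t).
apply: (@measurable_fun_cvg _ _ _ _ q) => [n|t tab].
  apply: measurable_funTS; apply: measurable_funM => //.
  apply: measurable_funB => //; apply: measurableT_comp => //.
  exact: measurable_funD.
have tab' : a < t < b by move: tab; rewrite /= in_itv.
have sh : (fun n : nat => t + n.+1%:R^-1) @ \oo --> t.
  rewrite -[X in _ --> X]addr0; apply: cvgD; [exact: cvg_cst|exact: cvg_harmonic].
have shd : (fun n : nat => t + n.+1%:R^-1) @ \oo --> t^'.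
  move=> A At.
  have H : \forall n \near \oo, t + n.+1%:R^-1 != t -> A (t + n.+1%:R^-1) :=
    sh _ At.
  change (\forall n \near \oo, A (t + n.+1%:R^-1)).
  by apply: filterS H => n; apply; rewrite -subr_eq0 addrC addKr invr_eq0.
have := cvg_comp _ _ shd (hd _ tab'); apply: cvg_trans; apply: near_eq_cvg.
(* For large [n] the shifted point is still in the open interval, where [hr] and [h] agree. *)
near=> n; rewrite /= /q /hr !patchE !mem_set//.
  by rewrite [X in X^-1](_ : _ = n.+1%:R^-1) ?invrK//; ring.
near: n; have := @near_in_itvoo _ a b t tab; exact: sh.
Unshelve. all: by end_near. Qed.

(** The local slope bound by [|d x| + e] is the definition of the limit [d x]; at [a] and [b] this
    limit is taken from inside only. *)
Lemma increment_le_integral_derivative (R : realType) (h d : R -> R) (a b : R) :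
  a <= b ->
  (forall t, a <= t <= b ->
     (fun s => (s - t)^-1 *: (h s - h t)) @ within `[a, b] t^' --> d t) ->
  measurable_fun `[a, b] d /\
  (`|h b - h a|%:E <= \int[lebesgue_measure]_(x in `[a, b]) `|d x|%:E)%E.
Proof.
move=> ab hd.
have md : measurable_fun `[a, b] d.
  apply: measurable_fun_itv_cc; apply: (@measurable_derivative _ h) => t tab.
  rewrite -(within_itv_dnbhs _ _ _ _ tab); apply: hd.
  by case/andP: tab => /ltW-> /ltW->.
split => //; apply: increment_le_integral => //.
  exact: measurableT_comp.
move=> x xab e e0.
have ltde : `|d x| < `|d x| + e by rewrite ltrDl.
have H : \forall y \near x, y != x -> y \in `[a, b] ->
    `|(y - x)^-1 *: (h y - h x)| < `|d x| + e.
  exact: (cvgr_lt _ (cvg_norm (hd x xab)) _ ltde).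
apply: filterS H => y; rewrite in_itv/= => H yab.
have [->|yx] := eqVneq y x; first by rewrite !subrr normr0 mulr0.
have := ltW (H yx yab); rewrite normrZ normfV ler_pdivrMl ?normr_gt0 ?subr_eq0//.
by rewrite mulrC.
Qed.

(** * Gamma integrals *)

Section gamma_moments.
Context {R : realType} (l : R) (l0 : 0 < l).

(* Integration by parts; normalised to vanish at [+oo]. *)
Fixpoint gamma_primitive (n : nat) (x : R) : R :=
  if n is m.+1
  then (m.+1%:R * gamma_primitive m x - x ^+ m.+1 * expR (- l * x)) / l
  else - expR (- l * x) / l.

Lemma is_derive_expRM (c x : R) :
  is_derive x 1 (fun y => expR (c * y)) (c * expR (c * x)).
Proof.
have dc : is_derive x 1 (fun y : R => c * y) c.
  have := @is_deriveZ _ _ _ id c x 1 1 _; rewrite [c *: 1]mulr1; apply.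
have := @is_derive1_comp _ expR _ x _ _ (is_derive_expR _) dc.
by rewrite mulrC.
Qed.

(** In the inductive step the two terms [(n + 1) x ^ n exp (- l x)], from the induction hypothesis
    and from the product rule, cancel. *)
Lemma is_derive_gamma_primitive (n : nat) (x : R) :
  is_derive x 1 (gamma_primitive n) (x ^+ n * expR (- l * x)).
Proof.
have l_neq0 : l != 0 by rewrite gt_eqF.
elim: n => [|n IH].
  have -> : gamma_primitive 0 = (- l^-1) \*: (fun y => expR (- l * y)).
    by apply/funext => y; rewrite /= /GRing.scale/=; field.
  have De := is_derive_expRM (- l) x.
  apply: is_derive_eq; by rewrite expr0 mul1r /GRing.scale/=; field.
have De := is_derive_expRM (- l) x.
have -> : gamma_primitive n.+1 = l^-1 \*: ((n.+1%:R \*: gamma_primitive n) -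
     ((@id R) ^+ n.+1 * (fun y => expR (- l * y)))).
  by apply/funext => y; rewrite /= !fctE/= mulrC.
apply: is_derive_eq; rewrite !fctE /GRing.scale/=.
by field.
Qed.

(** As the primitive tends to 0 at infinity, this is minus the integral of [x ^ n exp (- l x)] over
    the half-line. *)
Lemma gamma_primitive0 (n : nat) :
  gamma_primitive n 0 = - n`!%:R / l ^+ n.+1.
Proof.
have l_neq0 : l != 0 by rewrite gt_eqF.
elim: n => [|n IH] /=; first by rewrite mulr0 expR0 expr1.
by rewrite IH factS natrM [0 ^+ _]expr0n/= mul0r subr0 [l ^+ n.+2]exprS; field; rewrite ?expf_neq0 ?l_neq0.
Qed.

(** The exponential dominates its Taylor term of order [n + 1], so the product is at most a constant
    over [x]. *)
Lemma cvg_exprM_expRN (n : nat) :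
  (fun x : R => x ^+ n * expR (- l * x)) @ +oo --> 0.
Proof.
have H : (n.+1`!%:R / l ^+ n.+1 * x^-1) @[x --> +oo] --> (0 : R).
  rewrite -[X in _ --> X](mulr0 (n.+1`!%:R / l ^+ n.+1)).
  apply: cvgM; first exact: cvg_cst.
  by apply/gtr0_cvgV0; [exact: nbhs_pinfty_gt|exact: cvg_id].
apply: (squeeze_cvgr _ (cvg_cst 0) H).
near=> x; have x0 : 0 < x by near: x; exact: nbhs_pinfty_gt.
rewrite mulr_ge0 ?exprn_ge0 ?expR_ge0 ?(ltW x0)//= mulNr expRN.
have : (l * x) ^+ n.+1 / n.+1`!%:R <= expR (l * x).
  apply: le_trans (expR_ge1Dxn n _); first by rewrite lerDr.
  by rewrite mulr_ge0 ?ltW.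
rewrite ler_pdivrMr ?ltr0n ?fact_gt0// exprMn => H'.
have c0 : 0 < l ^+ n.+1 * x by rewrite mulr_gt0 ?exprn_gt0.
rewrite ler_pdivrMr ?expR_gt0// -(ler_pM2l c0).
have -> : l ^+ n.+1 * x * x ^+ n = l ^+ n.+1 * x ^+ n.+1.
  by rewrite [x ^+ n.+1]exprS mulrA.
suff -> : l ^+ n.+1 * x * (n.+1`!%:R / l ^+ n.+1 * x^-1 * expR (l * x)) =
  expR (l * x) * n.+1`!%:R by [].
have ln0 : l ^+ n.+1 != 0 by rewrite expf_neq0 ?gt_eqF.
by field; rewrite ln0 gt_eqF.
Unshelve. all: by end_near. Qed.

Lemma cvg_gamma_primitive (n : nat) : gamma_primitive n @ +oo --> 0.
Proof.
have E0 := cvg_exprM_expRN.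
elim: n => [|n IH].
  have -> : gamma_primitive 0 = (fun x => - l^-1 * (x ^+ 0 * expR (- l * x))).
    by apply/funext => x; rewrite /= expr0; field; rewrite gt_eqF.
  rewrite -[X in _ --> X](mulr0 (- l^-1)); apply: cvgM => //; exact: cvg_cst.
rewrite -[X in _ --> X](_ : (n.+1%:R * 0 - 0) / l = 0); last first.
  by rewrite mulr0 subrr mul0r.
apply: cvgM; last exact: cvg_cst.
by apply: cvgB => //; apply: cvgM => //; exact: cvg_cst.
Qed.

End gamma_moments.

(** * Fisher information of the Erlang family *)

(** Differentiating the density in the rate multiplies it by [k / l - x]. Positivity is asked of
    [x ^+ k.-1] rather than of [x], so that [x = 0] is covered when [k = 1]. *)
Lemma is_derive_ln_erlang_pdf (R : realType) (k : nat) (l x : R) : (0 < k)%N ->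
  0 < l -> 0 < x ^+ k.-1 ->
  is_derive l 1 (fun s => ln (erlang_pdf k s x)) (k%:R / l - x).
Proof.
case: k => // k _ l0 xk0.
have f0 : (k`!%:R : R) != 0 by rewrite pnatr_eq0 -lt0n fact_gt0.
have p0 : 0 < erlang_pdf k.+1 l x.
  by rewrite /erlang_pdf/= divr_gt0 ?ltr0n ?fact_gt0// mulr_gt0 ?expR_gt0// mulr_gt0// exprn_gt0.
have E : is_derive l 1 (fun s => expR (- s * x)) (- x * expR (- l * x)).
  have -> : (fun s => expR (- s * x)) = (fun s => expR (- x * s)).
    by apply/funext => s; rewrite mulNr mulrC -mulNr.
  by rewrite [X in _ (_ * expR X)](_ : _ = - x * l); [exact: is_derive_expRM|ring].
have D : is_derive l 1 (fun s => erlang_pdf k.+1 s x)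
    ((k.+1%:R / l - x) * erlang_pdf k.+1 l x).
  have -> : (fun s => erlang_pdf k.+1 s x) = (x ^+ k / k`!%:R) \*:
      ((@id R) ^+ k.+1 * (fun s => expR (- s * x))).
    by apply/funext => s; rewrite /erlang_pdf/= !fctE/= /GRing.scale/=; field.
  apply: is_derive_eq; rewrite /erlang_pdf !fctE /GRing.scale/= exprS.
  by field; rewrite f0 gt_eqF.
have := @is_derive1_comp _ (@ln R) (fun s => erlang_pdf k.+1 s x) l _ _
  (is_derive1_ln p0) D.
by rewrite mulrCA mulVf ?mulr1// gt_eqF.
Qed.

(** In dimension one the derivative along the basis vector has the same difference quotients as the
    derivative in the rate. *)
Lemma score_erlang (R : realType) (k : nat) (xi : 'rV[R]_1) (i : 'I_1) (x : R) :
  (0 < k)%N -> 0 < xi 0 0 -> 0 < x ^+ k.-1 ->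
  score (@erlang_family R k) xi i x = k%:R / xi 0 0 - x.
Proof.
move=> k0 xi0 xk0.
rewrite -(@derive_val _ _ _ _ _ _ _ (is_derive_ln_erlang_pdf _ _ _ _ k0 xi0 xk0)).
rewrite /score /derive /erlang_family.
set u := (fun h : R => _); set v := (fun h : R => _).
suff -> : u = v by [].
by apply/funext => h; rewrite /u /v/= !mxE (ord1 i) eqxx.
Qed.

(** The score is the mean minus [x], so the Fisher information is the variance of the distribution.
    Expanding the square reduces it to Gamma integrals of three consecutive orders. *)
Lemma fisher_matrix_erlang (R : realType) (k : nat) (xi : 'rV[R]_1) :
  (0 < k)%N -> 0 < xi 0 0 ->
  fisher_matrix (@erlang_sample_space R) (@erlang_family R k) xi 0 0
    = k%:R / xi 0 0 ^+ 2.
Proof.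
(* From here on the shape is [k.+1], and the density carries [x ^+ k]. *)
case: k => // k _ xi0; rewrite mxE /expectation_density.
set l : R := xi 0 0.
have l_neq0 : l != 0 by rewrite gt_eqF.
have f0 : (k`!%:R : R) != 0 by rewrite pnatr_eq0 -lt0n fact_gt0.
pose c := l ^+ k.+1 / k`!%:R.
have c0 : 0 <= c by rewrite divr_ge0// exprn_ge0// ltW.
pose f x := c * ((k.+1%:R / l - x) * (k.+1%:R / l - x)) * x ^+ k * expR (- l * x).
pose F := c \*: ((k.+1%:R / l) ^+ 2 \*: gamma_primitive l k
  - (2 * (k.+1%:R / l)) \*: gamma_primitive l k.+1 + gamma_primitive l k.+2).
have DF (x : R) : is_derive x 1 F (f x).
  have D0 := is_derive_gamma_primitive l xi0 k x.
  have D1 := is_derive_gamma_primitive l xi0 k.+1 x.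
  have D2 := is_derive_gamma_primitive l xi0 k.+2 x.
  apply: is_derive_eq; rewrite /f /GRing.scale/= !exprS; ring.
have cF : continuous F.
  by move=> x; apply: differentiable_continuous; apply/derivable1_diffP; have [] := DF x.
have cf : continuous f.
  move=> x; rewrite /f; apply: cvgM; last first.
    apply: (@differentiable_continuous _ _ _ _ (fun y => expR (- l * y))).
    by apply/derivable1_diffP; have [] := is_derive_expRM (- l) x.
  apply: cvgM; last exact: exprn_continuous.
  apply: cvgM; first exact: cvg_cst.
  by apply: cvgM; (apply: cvgB; [exact: cvg_cst|exact: cvg_id]).
transitivity (\int[lebesgue_measure]_(x in `[0, +oo[) f x).
  apply: eq_Rintegral => x; rewrite inE /erlang_sample_space/= in_itv/= andbT => x0.
  have [xk0|] := ltP 0 (x ^+ k).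
    rewrite !score_erlang// /erlang_family /erlang_pdf /f /c -/l.
    by field; rewrite l_neq0.
  (* Only [x = 0]: the score is then a junk value, but the density vanishes. *)
  move=> xk0; have {}xk0 : x ^+ k = 0 by apply/le_anti; rewrite xk0 exprn_ge0.
  by rewrite /erlang_family /erlang_pdf /f xk0 !(mulr0, mul0r).
(* [F] vanishes at infinity, so the integral is [0 - F 0]. *)
rewrite (@Rintegral_ge0_continuous_FTC2y _ f F 0 0).
- have -> : F 0 = c * ((k.+1%:R / l) ^+ 2 * gamma_primitive l k 0
      - (2 * (k.+1%:R / l)) * gamma_primitive l k.+1 0 + gamma_primitive l k.+2 0) by [].
  rewrite !gamma_primitive0// /c !factS !natrM !exprS -!natr1.
  by field; rewrite expf_neq0//= f0 l_neq0.
- move=> x x0; apply: mulr_ge0; last exact: expR_ge0.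
  apply: mulr_ge0; last exact: exprn_ge0.
  by apply: mulr_ge0 => //; rewrite -expr2 sqr_ge0.
- exact: continuous_subspaceT.
- have -> : 0 = c * ((k.+1%:R / l) ^+ 2 * 0 - (2 * (k.+1%:R / l)) * 0 + 0) :> R.
    by rewrite !mulr0 subrr addr0 mulr0.
  apply: cvgM; first exact: cvg_cst.
  apply: cvgD; last exact: cvg_gamma_primitive.
  apply: cvgB; (apply: cvgM; [exact: cvg_cst|exact: cvg_gamma_primitive]).
- by move=> x _; have [] := DF x.
- exact: cvg_at_right_filter (cF 0).
- by move=> x _; rewrite derive1E; have [] := DF x.
Qed.

(** * Lower bound on the length of a curve *)

(** Chain rule for limits restricted to [A]. Carathéodory's factor [psi] avoids dividing by
    [u s - u t], which may vanish. *)
Lemma cvg_slope_comp (R : realType) (A : set R) (u phi : R -> R) (t l m : R) :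
  (fun s => (s - t)^-1 *: (u s - u t)) @ within A t^' --> l ->
  is_derive (u t) 1 phi m ->
  (fun s => (s - t)^-1 *: (phi (u s) - phi (u t))) @ within A t^' --> m * l.
Proof.
move=> ul /is_derive1_caratheodory[psi [phiE cpsi <-]].
have st : (fun s : R => s - t) @ within A t^' --> t - t.
  apply: cvg_within_filter; apply: cvg_within_filter.
  by apply: cvgB; [exact: cvg_id|exact: cvg_cst].
(* Continuity of [u] along [A], by multiplying the convergent quotient by [s - t]. *)
have ut : u @ within A t^' --> u t.
  have : (fun s => u t + (s - t) * ((s - t)^-1 *: (u s - u t))) @ within A t^'
      --> u t + (t - t) * l by apply: cvgD; [exact: cvg_cst|exact: cvgM].
  rewrite subrr mul0r addr0; apply: cvg_trans; apply: near_eq_cvg.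
  have neq : \forall s \near within A t^', s != t.
    by apply: cvg_within; exact: withinT.
  apply: filterS neq => s. rewrite -subr_eq0 => st0.
  by rewrite /GRing.scale/= mulrA divff// mul1r addrC subrK.
have : (fun s => psi (u s) * ((s - t)^-1 *: (u s - u t))) @ within A t^'
    --> psi (u t) * l.
  by apply: cvgM => //; exact: cvg_comp ut cpsi.
apply: cvg_trans; apply: near_eq_cvg.
by near=> s; rewrite /= phiE /GRing.scale/= mulrCA.
Unshelve. all: by end_near. Qed.

(** The integrand of [fisher_length], named because its measurability is carried along with the
    length bounds. *)
Definition erlang_speed {R : realType} (k : nat) (g : R -> 'rV[R]_1) (t : R) : R :=
  Num.sqrt ((derive1 g t *m
    fisher_matrix (@erlang_sample_space R) (@erlang_family R k) (g t) *m
    (derive1 g t)^T) 0 0).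

Lemma erlang_speedE (R : realType) (k : nat) (g : R -> 'rV[R]_1) (t : R)
    (l : 'rV[R]_1) : (0 < k)%N -> 0 < g t 0 0 -> is_derive t 1 g l ->
  erlang_speed k g t = `|Num.sqrt k%:R * ((g t 0 0)^-1 * l 0 0)|.
Proof.
move=> k0 gt0 [_ dg]; rewrite /erlang_speed derive1E dg.
rewrite !mxE big_ord1 !mxE big_ord1 fisher_matrix_erlang//.
have -> : l 0 0 * (k%:R / g t 0 0 ^+ 2) * l 0 0 = k%:R * ((g t 0 0)^-1 * l 0 0) ^+ 2.
  by field; rewrite gt_eqF.
by rewrite sqrtrM// sqrtr_sqr [RHS]normrM (ger0_norm (sqrtr_ge0 k%:R)).
Qed.

Section log_rate_increment.
Context {R : realType} (k : nat) (k0 : (0 < k)%N) (g : R -> 'rV[R]_1).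

Definition log_rate (t : R) : R := Num.sqrt k%:R * ln (g t 0 0).

(** At [a] and [b] only the one-sided derivative [L] is controlled, and [derive1 g] may differ from
    it. These two points are null, so the speed is compared with [|d|] on the open interval. *)
Lemma log_rate_increment_segment (a b : R) : a <= b ->
  differentiable_on_segment g a b -> (forall t, a <= t <= b -> 0 < g t 0 0) ->
  measurable_fun `[a, b] (erlang_speed k g) /\
  (`|log_rate b - log_rate a|%:E <=
    \int[lebesgue_measure]_(t in `[a, b]) (erlang_speed k g t)%:E)%E.
Proof.
move=> ab dg g0.
pose L t := lim ((fun s => (s - t)^-1 *: (g s - g t)) @ within `[a, b] t^').
pose d t := Num.sqrt k%:R * ((g t 0 0)^-1 * L t 0 0).
have gL t : a <= t <= b ->
    (fun s => (s - t)^-1 *: (g s - g t)) @ within `[a, b] t^' --> L t.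
  by move=> tab; apply: dg; rewrite in_itv.
have hd t : a <= t <= b ->
    (fun s => (s - t)^-1 *: (log_rate s - log_rate t)) @ within `[a, b] t^' --> d t.
  move=> tab; rewrite /d mulrA.
  apply: (@cvg_slope_comp _ _ (fun s => g s 0 0) (fun x => Num.sqrt k%:R * ln x)).
    have := cvg_comp _ _ (gL t tab) (@coord_continuous _ 1 1 0 0 (L t)).
    by apply: cvg_trans; apply: near_eq_cvg; near=> s; rewrite /= !mxE.
  have Dln := is_derive1_ln (g0 t tab).
  have -> : (fun x => Num.sqrt k%:R * ln x) = Num.sqrt k%:R \*: @ln R by [].
  by apply: is_derive_eq.
have [md hle] := increment_le_integral_derivative _ _ _ _ _ ab hd.
have speedE t : a < t < b -> erlang_speed k g t = `|d t|.
  move=> tab; have tab' : a <= t <= b by case/andP: tab => /ltW-> /ltW->.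
  apply: erlang_speedE => //; first exact: g0.
  by apply/cvg_slope_is_derive; rewrite -(within_itv_dnbhs _ _ _ _ tab); exact: gL.
have mnd : measurable_fun `[a, b] (fun t => `|d t|) by exact: measurableT_comp.
have mndo : measurable_fun `]a, b[ (fun t => `|d t|).
  by apply: measurable_funS mnd => //; exact: subset_itv_oo_cc.
have mso : measurable_fun `]a, b[ (erlang_speed k g).
  by apply: eq_measurable_fun mndo => t; rewrite inE/= in_itv/= => /speedE ->.
split; first exact: measurable_fun_itv_cc mso.
apply: (le_trans hle).
rewrite integral_itv_bndoo; last exact/measurable_EFinP.
rewrite [leRHS]integral_itv_bndoo; last exact/measurable_EFinP.
rewrite le_eqVlt; apply/orP; left; apply/eqP; apply: eq_integral => t.
by rewrite inE/= in_itv/= => /speedE ->.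
Unshelve. all: by end_near. Qed.

(** Induction on the breakpoints: triangle inequality on the left, additivity of the integral on the
    right. The latter requires the measurability included in the conclusion. *)
Lemma log_rate_increment_partition (a b : R) (s : seq R) : itv_partition a b s ->
  (forall i, (i < size s)%N ->
     differentiable_on_segment g (nth 0 (a :: s) i) (nth 0 s i)) ->
  (forall t, a <= t <= b -> 0 < g t 0 0) ->
  measurable_fun `[a, b] (erlang_speed k g) /\
  (`|log_rate b - log_rate a|%:E <=
    \int[lebesgue_measure]_(t in `[a, b]) (erlang_speed k g t)%:E)%E.
Proof.
elim: s a => [|x s IH] a.
  move=> /itv_partition_nil-> _ _; rewrite subrr normr0; split.
    by rewrite set_itv1; exact: measurable_fun_set1.
  by apply: integral_ge0 => t _; rewrite lee_fin sqrtr_ge0.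
move=> part dg g0.
have ax : a < x by have [/= /andP[]] := part.
have xb := itv_partition_le (itv_partition_cons part).
have [|t /andP[at_ tx]|m1 h1] := log_rate_increment_segment a x (ltW ax).
- exact: (dg 0%N).
- by apply: g0; rewrite at_ (le_trans tx).
have [|i si|t /andP[xt tb]|m2 h2] := IH x.
- exact: itv_partition_cons part.
- exact: (dg i.+1).
- by apply: g0; rewrite tb (le_trans (ltW ax)).
have itvU : `[a, b]%classic = `[a, x] `|` `]x, b] :> set R.
  by rewrite -(@itv_bndbnd_setU _ _ _ (BRight x))// bnd_simp ltW.
have m2' : measurable_fun `]x, b] (erlang_speed k g).
  by apply: measurable_funS m2 => //; exact: subset_itv_oc_cc.
have mU : measurable_fun `[a, b] (erlang_speed k g).
  by rewrite itvU; apply/measurable_funU.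
split => //; rewrite itvU ge0_integral_setU//=; first last.
- apply/disj_setPS => t [] /=; rewrite !in_itv/= => /andP[_ tx] /andP[xt _].
  by have := lt_le_trans xt tx; rewrite ltxx.
- by move=> t _; rewrite lee_fin sqrtr_ge0.
- by rewrite -itvU; exact/measurable_EFinP.
apply: (@le_trans _ _ (`|log_rate x - log_rate a|%:E + `|log_rate b - log_rate x|%:E)%E).
  rewrite -EFinD lee_fin [leRHS]addrC.
  by rewrite (_ : log_rate b - log_rate a =
    (log_rate b - log_rate x) + (log_rate x - log_rate a)) ?ler_normD//; ring.
apply: leeD => //; rewrite integral_itv_obnd_cbnd//.
exact/measurable_EFinP.
Qed.

End log_rate_increment.

(** * The exponential curve and the distance *)

Lemma is_derive_const_mx_expR (R : realType) (c m t : R) :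
  is_derive t 1 (fun s => const_mx (c * expR (m * s)) : 'rV[R]_1)
    (const_mx (c * (m * expR (m * t)))).
Proof.
have De : is_derive t 1 (fun s => c * expR (m * s)) (c * (m * expR (m * t))).
  have De := is_derive_expRM m t.
  have -> : (fun s => c * expR (m * s)) = c \*: (fun s => expR (m * s)) by [].
  exact: is_derive_eq.
have coordE (i j : 'I_1) : (fun s => (const_mx (c * expR (m * s)) : 'rV[R]_1) i j) =
    (fun s => c * expR (m * s)) by apply/funext => s; rewrite mxE.
have dg : derivable (fun s => const_mx (c * expR (m * s)) : 'rV[R]_1) t 1.
  by apply/derivable_mxP => i j; rewrite coordE; have [] := De.
apply: DeriveDef => //; rewrite derive_mx//.
by apply/matrixP => i j; rewrite !mxE coordE; have [] := De.
Qed.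

Theorem mainTheorem3 (R : realType) (k : nat) (k_ge1 : (1 <= k)%N) :
  (forall l : R, 0 < l ->
     fisher_matrix (@erlang_sample_space R) (@erlang_family R k)
       (const_mx l) 0 0 = k%:R / l ^+ 2) /\
  (forall l1 l2 : R, 0 < l1 -> 0 < l2 ->
     fisher_rao_distance (@erlang_sample_space R) (@erlang_parameters R)
       (@erlang_family R k) (const_mx l1) (const_mx l2) =
     (Num.sqrt k%:R * `|ln l1 - ln l2|)%:E).
Proof.
split=> [l l0|l1 l2 l10 l20].
  by rewrite fisher_matrix_erlang// mxE.
apply/le_anti/andP; split; last first.
  apply: le_ereal_inf_tmp => _ [g [[s [part dg]] gpos g0 g1] <-].
  have [|_] := log_rate_increment_partition k k_ge1 g 0 1 s part dg.
    by move=> t t01; apply: gpos; rewrite in_itv.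
  by rewrite /log_rate g0 g1 !mxE -mulrBr normrM ger0_norm ?sqrtr_ge0// distrC.
(* With this exponent the curve [l1 exp (m t)] reaches [l2] at [t = 1]. *)
pose m := ln l2 - ln l1.
pose g (t : R) : 'rV[R]_1 := const_mx (l1 * expR (m * t)).
have g0 t : 0 < g t 0 0 by rewrite mxE mulr_gt0 ?expR_gt0.
apply: ereal_inf_lbound; exists g.
  split=> [|t _||]; first 2 last.
  - by rewrite /g mulr0 expR0 mulr1.
  - rewrite /g mulr1 /m expRD expRN !lnK ?posrE//; congr const_mx.
    by field; rewrite gt_eqF.
  - exists [:: 1]; split; first exact: itv_partition1.
    move=> [|//] _ t t01; apply: cvg_app_within; apply/cvg_ex.
    by eexists; apply/cvg_slope_is_derive; exact: is_derive_const_mx_expR.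
  - exact: g0.
rewrite /fisher_length.
(* The derivative of the curve is [m] times the curve, so dividing by the rate leaves the constant
   speed [sqrt k * |m|]. *)
transitivity (\int[lebesgue_measure]_(t in `[0%R, 1%R])
    (cst (Num.sqrt k%:R * `|ln l1 - ln l2|)%:E) t)%E.
  apply: eq_integral => t _; congr EFin.
  have := erlang_speedE R k g t _ k_ge1 (g0 t) (is_derive_const_mx_expR R l1 m t).
  rewrite /erlang_speed => ->; rewrite !mxE normrM ger0_norm ?sqrtr_ge0//.
  congr (_ * _); rewrite distrC -/m; congr (`|_|); field.
  by rewrite !gt_eqF ?expR_gt0.
rewrite integral_cst//= lebesgue_measure_itv/= lte_fin ltr01 oppr0 adde0 mule1.
by [].
Qed.
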